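(* Let $F$ be admissible such that $G(\cdot,t)$ is $F$-concave in $\mathbf{R}^N$ for some $t>0$. Then every bounded nonnegative function $u$ in $\mathbf{R}^N$ that is $2$-logconcave in $\mathbf{R}^N$ is $F$-concave in $\mathbf{R}^N$ (in other words, $\mathcal{C}[L_2]\subset\mathcal{C}[F]$). Furthermore, for any $t>0$, $$\mathcal{C}[L_2]=\bigcap_{F\in\{H\,:\,G(\cdot,t)\in\mathcal{C}[H]\}}\mathcal{C}[F],$$ where the intersection is over admissible functions.
   Context: $G(x,t):=(4\pi t)^{-N/2}\exp\left(-\frac{|x|^2}{4t}\right)$, $x\in\mathbf{R}^N$, $t>0$, is the Gauss kernel. A function $F:[0,1]\to\mathbf{R}\cup\{-\infty\}$ is called admissible if $F$ is strictly increasing and continuous in $(0,1]$, $F(0)=-\infty$, and $F(s)\neq-\infty$ for $s>0$. Let $F$ be admissible. A bounded nonnegative function $u$ in $\mathbf{R}^N$ is $F$-concave in $\mathbf{R}^N$ if, for all sufficiently small $\kappa>0$, one has $0\le\kappa u\le1$ in $\mathbf{R}^N$ and $$F(\kappa u((1-\mu)x+\mu y))\ge(1-\mu)F(\kappa u(x))+\mu F(\kappa u(y)),\qquad x,y\in\mathbf{R}^N,\ \mu\in[0,1].$$ Here $-\infty$ is handled in the obvious way: $-\infty+a=-\infty$ for $a\in\mathbf{R}$, $-\infty\ge-\infty$, and the inequality is trivially true for $\mu\in\{0,1\}$. $\mathcal{C}[F]$ denotes the set of $F$-concave functions in $\mathbf{R}^N$. $L_2:[0,1]\to\mathbf{R}\cup\{-\infty\}$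 is the admissible function $L_2(s):=-(-\log s)^{1/2}$ for $s\in(0,1]$, $L_2(0):=-\infty$; $2$-logconcave means $L_2$-concave. *)

(* Defs.v *)
From HB Require Import structures.
From mathcomp Require Import all_boot all_order all_algebra.
From mathcomp Require Import all_classical all_reals all_analysis.

Set Implicit Arguments.
Unset Strict Implicit.
Unset Printing Implicit Defensive.

Import Order.TTheory GRing.Theory Num.Theory.
Import numFieldNormedType.Exports.

Local Open Scope classical_set_scope.
Local Open Scope ring_scope.

(* The library norm on 'rV[R]_N is the sup norm, hence the explicit sum. *)
Definition sqnorm2 (R : realType) (N : nat) (x : 'rV[R]_N) : R :=
  \sum_(i < N) x ord0 i ^+ 2.

Definition gauss (R : realType) (N : nat) (t : R) (x : 'rV[R]_N) : R :=
  (4 * pi * t) `^ (- (N%:R / 2)) * expR (- (sqnorm2 x / (4 * t))).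
Arguments gauss {R} N t x.

(* A function [0, 1] -> R \cup {-oo} is represented by a function R -> \bar R:
   its values outside [0, 1] are unconstrained, and are never used by
   [admissible] or [F_concave]. *)
Definition admissible (R : realType) (F : R -> \bar R) : Prop :=
  [/\ F 0 = -oo%E,
      forall s : R, 0 < s <= 1 -> F s \is a fin_num,
      forall s s' : R, 0 < s -> s < s' -> s' <= 1 -> (F s < F s')%E &
      {within `]0, 1], continuous F}].

(* In \bar R, 0 * -oo = 0 and c * -oo = -oo for c > 0, so the inequality
   follows the usual conventions for -oo and is an equality when mu is 0 or
   1. *)
Definition F_concave (R : realType) (N : nat) (F : R -> \bar R)
    (u : 'rV[R]_N -> R) : Prop :=
  [/\ bounded_fun u,
      forall x, 0 <= u x &
      \forall k \near (0 : R)^'+,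
        (forall x, 0 <= k * u x <= 1) /\
        (forall (x y : 'rV[R]_N) (mu : R), 0 <= mu <= 1 ->
          ((1 - mu)%:E * F (k * u x)%R + mu%:E * F (k * u y)%R
             <= F (k * u ((1 - mu) *: x + mu *: y))%R)%E)].

Definition F_concave_class (R : realType) (N : nat) (F : R -> \bar R) :
    set ('rV[R]_N -> R) :=
  [set u | F_concave F u].
Arguments F_concave_class {R} N F.

Definition L2 (R : realType) (s : R) : \bar R :=
  if s == 0 then -oo%E else (- Num.sqrt (- ln s))%:E.
Arguments L2 {R} s.

(* Main.v *)
Require Import Defs.
From HB Require Import structures.
From mathcomp Require Import all_boot all_order all_algebra.
From mathcomp Require Import all_classical all_reals all_analysis.
From mathcomp Require Import ring lra.

(** For [0 < v <= 1] write [v = expR (- w ^+ 2)] with [w = Num.sqrt (- ln v)].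
    In this coordinate 2-logconcavity of [v] is exactly convexity of [w], and
    this is how the Gauss kernel enters: along a line through the origin,
    parametrized suitably by [r], a small multiple of it is
    [a * expR (- r ^+ 2)], where [a] is any small positive number.

    Let [G(., t)] be [F]-concave. Restricting to that line shows that for all
    small [a] the profile [r |-> F (a * expR (- r ^+ 2))] is concave
    ([gauss_profile_concave]), and it is nonincreasing in [r >= 0] as [F] is
    increasing. If [u] is 2-logconcave, fix one [k0] for which
    [k0 * u = expR (- w ^+ 2)] with [w] convex. A smaller factor [k = a * k0]
    gives [F (k * u) = F (a * expR (- w ^+ 2))], a nonincreasing concave function
    of the convex function [w], hence concave ([F_concave_of_L2_concave]). The
    factor [k] is split in this way because [F (expR (- r ^+ 2))] itself need not
    be concave in [r]: the hypothesis speaks of the profiles with a small factor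
    [a], which is why [k0] stays fixed while [a] tends to 0.

    In dimension 0 there is no line to restrict to, but every function lives on
    a single point and is [F]-concave.

    The inclusion from left to right in the second claim is the first one.
    Conversely [L2] is itself a member of the family of the intersection: it is
    admissible, and [G(., t)] is 2-logconcave because
    [Num.sqrt (sqnorm2 x / (4 * t) + c)] is convex in [x]
    ([sqrt_sqnorm2_convex]). *)

Set Implicit Arguments.
Unset Strict Implicit.
Unset Printing Implicit Defensive.

Import Order.TTheory GRing.Theory Num.Theory.
Import numFieldNormedType.Exports.

Local Open Scope classical_set_scope.
Local Open Scope ring_scope.

(** * Concavity inequalities with values in the extended reals *)

Lemma near_right0_scale (R : realType) (c : R) (P : set R) : 0 < c ->
  (\forall k \near (0 : R)^'+, P k) -> \forall k \near (0 : R)^'+, P (c * k).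
Proof.
move=> c0 /nbhs_ballP[e /= e0 eP]; near=> k; apply: eP.
  rewrite /ball/= sub0r normrN gtr0_norm ?mulr_gt0//.
  rewrite mulrC -ltr_pdivlMr//; near: k; apply: nbhs_right_lt.
  exact: divr_gt0.
by rewrite mulr_gt0.
Unshelve. all: by end_near. Qed.

Lemma admissible_le (R : realType) (F : R -> \bar R) (s s' : R) :
  admissible F -> 0 < s -> s <= s' -> s' <= 1 -> (F s <= F s')%E.
Proof.
move=> [_ _ Finc _] s0; rewrite le_eqVlt => /predU1P[-> //|ss'] s'1.
exact/ltW/Finc.
Qed.

(** The conventions for [-oo] make the concavity inequality hold whenever an
    endpoint value [a] or [b] is 0 or [mu] is 0 or 1. What remains is an
    inequality between positive arguments, where [F] is finite. Here [c] is the
    value at the convex combination of the two points with values [a], [b]. *)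
Lemma F_jensen_nontrivial (R : realType) (F : R -> \bar R) (a b c mu : R) :
  admissible F -> 0 <= a <= 1 -> 0 <= b <= 1 -> 0 <= mu <= 1 ->
  (mu = 0 -> c = a) -> (mu = 1 -> c = b) ->
  (0 < mu < 1 -> 0 < a -> 0 < b ->
    ((1 - mu)%:E * F a + mu%:E * F b <= F c)%E) ->
  ((1 - mu)%:E * F a + mu%:E * F b <= F c)%E.
Proof.
move=> [F0 Ffin _ _] /andP[a0 a1] /andP[b0 b1] /andP[mu0 mu1] c0 c1 H.
have [mu_eq0|mu_neq0] := eqVneq mu 0.
  by rewrite (c0 mu_eq0) mu_eq0 subr0 mul1e mul0e adde0.
have [mu_eq1|mu_neq1] := eqVneq mu 1.
  by rewrite (c1 mu_eq1) mu_eq1 subrr mul1e mul0e add0e.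
have mugt0 : 0 < mu by rewrite lt_def mu_neq0.
have mult1 : mu < 1 by rewrite lt_def eq_sym mu_neq1.
have [a_eq0|a_neq0] := eqVneq a 0.
  by rewrite a_eq0 F0 gt0_muleNy ?lte_fin ?subr_gt0// addNye leNye.
have [b_eq0|b_neq0] := eqVneq b 0.
  by rewrite b_eq0 F0 gt0_muleNy ?lte_fin// addeNy leNye.
by apply: H; rewrite ?mugt0// lt_def ?a_neq0 ?b_neq0.
Qed.

(** * The function L2 and the Gauss kernel *)

Lemma L2_pos (R : realType) (s : R) : 0 < s -> L2 s = (- Num.sqrt (- ln s))%:E.
Proof. by move=> s0; rewrite /L2 gt_eqF. Qed.

Lemma admissible_L2 (R : realType) : admissible (@L2 R).
Proof.
split.
- by rewrite /L2 eqxx.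
- by move=> s /andP[s0 _]; rewrite L2_pos.
- move=> s s' s0 ss' s'1.
  have s'0 := lt_trans s0 ss'.
  rewrite !L2_pos// lte_fin ltrN2 ltr_sqrt.
    by rewrite ltrN2 ltr_ln// posrE.
  by rewrite oppr_gt0 ln_lt0// s0 (lt_le_trans ss').
- apply: (@subspace_eq_continuous _ _ _
    (fun s : R => (- Num.sqrt (- ln s))%:E)).
    by move=> s; rewrite inE/= in_itv/= => /andP[s0 _]; rewrite /from_subspace/= L2_pos.
  apply: continuous_in_subspaceT => s; rewrite inE/= in_itv/= => /andP[s0 _].
  apply: cvg_EFin; first exact: nearW.
  apply: cvgN.
  apply: (@cvg_comp _ _ _ (fun s : R => - ln s) Num.sqrt); last first.
    exact: sqrt_continuous.
  by apply: cvgN; exact: continuous_ln.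
Qed.

Lemma expR_sqr_sqrt_ln (R : realType) (v : R) : 0 < v <= 1 ->
  v = expR (- Num.sqrt (- ln v) ^+ 2).
Proof.
move=> /andP[v0 v1].
by rewrite sqr_sqrtr ?opprK ?lnK ?posrE// oppr_ge0 ln_le0.
Qed.

Lemma sqnorm2_ge0 (R : realType) (N : nat) (x : 'rV[R]_N) : 0 <= sqnorm2 x.
Proof. by apply: sumr_ge0 => i _; rewrite sqr_ge0. Qed.

(** For [d = 1] the function [Num.sqrt (sqnorm2 x + c)] is the Euclidean norm of
    [x] extended by the extra coordinate [Num.sqrt c]; convexity is the triangle
    inequality in that space of one more dimension. *)
Lemma sqrt_sqnorm2_convex (R : realType) (N : nat) (c : R) (x y : 'rV[R]_N)
    (d mu : R) :
  0 < c -> 0 <= d -> 0 <= mu <= 1 ->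
  Num.sqrt (d * sqnorm2 ((1 - mu) *: x + mu *: y) + c)
    <= (1 - mu) * Num.sqrt (d * sqnorm2 x + c)
       + mu * Num.sqrt (d * sqnorm2 y + c).
Proof.
move=> c0 d0 /andP[mu0 mu1].
have A0 (z : 'rV[R]_N) : 0 < d * sqnorm2 z + c.
  by rewrite ltr_wpDl// mulr_ge0// sqnorm2_ge0.
set p := Num.sqrt (_ * sqnorm2 x + c); set q := Num.sqrt (_ * sqnorm2 y + c).
have p0 : 0 < p by rewrite sqrtr_gt0.
have q0 : 0 < q by rewrite sqrtr_gt0.
have p2 : p ^+ 2 = d * sqnorm2 x + c by rewrite sqr_sqrtr// ltW.
have q2 : q ^+ 2 = d * sqnorm2 y + c by rewrite sqr_sqrtr// ltW.
pose xy := \sum_(i < N) x ord0 i * y ord0 i.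
have expand (a b : R) : sqnorm2 (a *: x + b *: y) =
    a ^+ 2 * sqnorm2 x + b ^+ 2 * sqnorm2 y + 2 * a * b * xy.
  rewrite /sqnorm2 /xy !mulr_sumr -!big_split/=.
  by apply: eq_bigr => i _; rewrite !mxE; ring.
(* Cauchy-Schwarz for the extended vectors of norms [p] and [q], obtained by
   expanding the squared norm of their combination with weights [q], [- p]. *)
have cross : d * xy + c <= p * q.
  have h1 := mulr_ge0 d0 (sqnorm2_ge0 (q *: x + (- p) *: y)).
  rewrite expand in h1.
  have h2 := mulr_ge0 (ltW c0) (sqr_ge0 (q - p)).
  have pq0 : 0 < p * q by exact: mulr_gt0.
  rewrite -(ler_pM2l pq0).
  have -> : p * q * (p * q) = (q ^+ 2 * (d * sqnorm2 x + c)
      + p ^+ 2 * (d * sqnorm2 y + c)) / 2 by rewrite -p2 -q2; field.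
  lra.
have r0 : 0 <= (1 - mu) * p + mu * q.
  by rewrite addr_ge0 ?mulr_ge0 ?subr_ge0// ltW.
rewrite -(ler_pXn2r (_ : 0 < 2)%N) ?nnegrE ?sqrtr_ge0//.
rewrite sqr_sqrtr ?(ltW (A0 _))// expand.
have : 0 <= 2 * ((1 - mu) * mu) * (p * q - (d * xy + c)).
  by rewrite !mulr_ge0 ?subr_ge0.
have -> : ((1 - mu) * p + mu * q) ^+ 2 = (1 - mu) ^+ 2 * p ^+ 2
    + mu ^+ 2 * q ^+ 2 + 2 * ((1 - mu) * mu) * (p * q) by ring.
rewrite p2 q2.
rewrite -subr_ge0; set A := (X in _ -> _ <= X); set B := (X in 0 <= X -> _).
by have -> : A = B by rewrite /A /B; ring.
Qed.

Definition gauss_max (R : realType) (N : nat) (t : R) : R :=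
  (4 * pi * t) `^ (- (N%:R / 2)).

Lemma gauss_max_gt0 (R : realType) (N : nat) (t : R) : 0 < t ->
  0 < gauss_max N t.
Proof. by move=> t0; rewrite powR_gt0// !mulr_gt0// pi_gt0. Qed.

Lemma gauss_gt0 (R : realType) (N : nat) (t : R) (x : 'rV[R]_N) : 0 < t ->
  0 < gauss N t x.
Proof. by move=> t0; rewrite mulr_gt0 ?expR_gt0 ?gauss_max_gt0. Qed.

Lemma gauss_le_max (R : realType) (N : nat) (t : R) (x : 'rV[R]_N) : 0 < t ->
  gauss N t x <= gauss_max N t.
Proof.
move=> t0; apply: ler_piMr; first exact/ltW/gauss_max_gt0.
rewrite -[leRHS]expR0 ler_expR oppr_le0.
by rewrite divr_ge0 ?sqnorm2_ge0// mulr_ge0// ltW.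
Qed.

(** Multiplying by [k] adds [- ln (k * gauss_max N t)] to the squared coordinate
    [sqnorm2 x / (4 * t)]; for small [k] this constant is positive and
    [sqrt_sqnorm2_convex] applies. *)
Lemma gauss_L2_concave (R : realType) (N : nat) (t : R) : 0 < t ->
  F_concave L2 (@gauss R N t).
Proof.
move=> t0; have M0 := gauss_max_gt0 N t0; split.
- exists (gauss_max N t); split; first exact: num_real.
  move=> M MM x _ /=; rewrite ger0_norm ?ltW ?gauss_gt0//.
  exact: le_lt_trans (gauss_le_max x t0) MM.
- by move=> x; rewrite ltW// gauss_gt0.
near=> k.
have k0 : 0 < k by near: k; exact: nbhs_right_gt.
have kM : k * gauss_max N t < 1.
  rewrite -ltr_pdivlMr// div1r.
  by near: k; apply: nbhs_right_lt; rewrite invr_gt0.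
have v0 (x : 'rV[R]_N) : 0 < k * gauss N t x by rewrite mulr_gt0// gauss_gt0.
split=> [x|x y mu mu01].
  rewrite ltW//=; apply: le_trans (ltW kM).
  by rewrite ler_pM2l// gauss_le_max.
have lnv (z : 'rV[R]_N) : - ln (k * gauss N t z) =
    (4 * t)^-1 * sqnorm2 z - ln (k * gauss_max N t).
  rewrite /gauss mulrA lnM ?posrE ?expR_gt0 ?mulr_gt0// expRK.
  rewrite -/(gauss_max N t); ring.
rewrite !L2_pos// -!EFinM -EFinD lee_fin !lnv !mulrN -opprD lerN2.
apply: sqrt_sqnorm2_convex => //.
  by rewrite oppr_gt0 ln_lt0// kM mulr_gt0.
by rewrite invr_ge0 mulr_ge0// ltW.
Unshelve. all: by end_near. Qed.

(** * 2-logconcave functions are F-concave *)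

Lemma F_concave_dim0 (R : realType) (F : R -> \bar R) (u : 'rV[R]_0 -> R) :
  admissible F -> bounded_fun u -> (forall x, 0 <= u x) -> F_concave F u.
Proof.
move=> adm ub u0; split => //.
have u1 : 0 < u 0 + 1 by rewrite ltr_wpDl.
near=> k.
have k0 : 0 < k by near: k; exact: nbhs_right_gt.
have ku1 x : k * u x <= 1.
  rewrite (thinmx0 x).
  apply: (@le_trans _ _ (k * (u 0 + 1))).
    by rewrite ler_pM2l// lerDl.
  rewrite -ler_pdivlMr// div1r; near: k; apply: nbhs_right_le.
  by rewrite invr_gt0.
have ku01 x : 0 <= k * u x <= 1 by rewrite ku1 mulr_ge0// ltW.
split=> // x y mu mu01.
rewrite [_ + mu *: y]thinmx0 (thinmx0 x) (thinmx0 y).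
apply: F_jensen_nontrivial => // mu01' a0 _.
case: adm => _ Ffin _ _.
rewrite -(fineK (Ffin (k * u 0) _)) ?a0 ?ku1//.
by rewrite -!EFinM -EFinD lee_fin -mulrDl subrK mul1r.
Unshelve. all: by end_near. Qed.

(** The kernel is restricted to the first coordinate axis, on which [r] is
    measured in units of [Num.sqrt (4 * t)]. *)
Lemma gauss_profile_concave (R : realType) (n : nat) (F : R -> \bar R)
    (t k : R) : 0 < t ->
  (forall (x y : 'rV[R]_n.+1) (mu : R), 0 <= mu <= 1 ->
    ((1 - mu)%:E * F (k * gauss n.+1 t x)%R
       + mu%:E * F (k * gauss n.+1 t y)%R
     <= F (k * gauss n.+1 t ((1 - mu) *: x + mu *: y))%R)%E) ->
  forall r s mu : R, 0 <= mu <= 1 ->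
    ((1 - mu)%:E * F (k * gauss_max n.+1 t * expR (- r ^+ 2))%R
       + mu%:E * F (k * gauss_max n.+1 t * expR (- s ^+ 2))%R
     <= F (k * gauss_max n.+1 t
             * expR (- ((1 - mu) * r + mu * s) ^+ 2))%R)%E.
Proof.
move=> t0 H r s mu mu01.
pose e (r : R) : 'rV[R]_n.+1 :=
  (Num.sqrt (4 * t) * r) *: delta_mx ord0 ord0.
have t40 : 0 < 4 * t by rewrite mulr_gt0.
have He (z : R) : k * gauss n.+1 t (e z) =
    k * gauss_max n.+1 t * expR (- z ^+ 2).
  rewrite /gauss -[RHS]mulrA; congr (_ * (_ * expR (- _))).
  rewrite /sqnorm2 (bigD1 ord0)//= big1 ?addr0.
    by rewrite !mxE !eqxx/= mulr1 exprMn sqr_sqrtr ?ltW// mulrC mulKf// gt_eqF.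
  by move=> i /negbTE i0; rewrite !mxE i0 andbF mulr0 expr0n.
have := H (e r) (e s) mu mu01.
have -> : (1 - mu) *: e r + mu *: e s = e ((1 - mu) * r + mu * s).
  by rewrite /e !scalerA -scalerDl; congr (_ *: _); ring.
by rewrite !He.
Qed.

(** Composition of the nonincreasing concave profile of [gauss_profile_concave]
    with the convex function [Num.sqrt (- ln (k0 * u))]. *)
Lemma F_concave_of_L2_concave (R : realType) (N : nat) (F : R -> \bar R)
    (u : 'rV[R]_N -> R) : admissible F ->
  (exists2 t : R, 0 < t & F_concave F (gauss N t)) ->
  F_concave L2 u -> F_concave F u.
Proof.
case: N u => [|n] u adm [t t0 [_ _ gaussF]] [ub u0 uL2].
  exact: F_concave_dim0.
split=> //.
have [k0 [k0gt0 [v01 vL2]]] :=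
  filter_ex (filterI (nbhs_right_gt (0 : R)) uL2).
have M0 := gauss_max_gt0 n.+1 t0.
set M := gauss_max n.+1 t in M0.
(* The kernel is taken with the factor [k / (M * k0)], so that its maximum is
   the [a = k / k0] by which [k0 * u] is to be multiplied. *)
have c0 : 0 < (M * k0)^-1 by rewrite invr_gt0 mulr_gt0.
have := near_right0_scale c0 gaussF; apply: filter_app.
near=> k.
have kgt0 : 0 < k by near: k; exact: nbhs_right_gt.
have kk0 : k <= k0 by near: k; exact: nbhs_right_le.
set a := k / k0.
have a0 : 0 < a by rewrite divr_gt0.
have a1 : a <= 1 by rewrite ler_pdivrMr ?mul1r.
move=> [_ /(gauss_profile_concave t0)]; rewrite -/M.
have -> : (M * k0)^-1 * k * M = a.
  by rewrite /a; field; rewrite !gt_eqF.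
move=> prof.
have kE x : k * u x = a * (k0 * u x) by rewrite /a mulrA divfK// gt_eqF.
have ku01 x : 0 <= k * u x <= 1.
  rewrite kE; have /andP[vx0 vx1] := v01 x.
  by rewrite mulr_ge0 ?(ltW a0)//= mulr_ile1// ltW.
split=> // x y mu mu01.
set z := (1 - mu) *: x + mu *: y.
apply: F_jensen_nontrivial => //.
- by move=> mu_eq0; rewrite /z mu_eq0 subr0 scale1r scale0r addr0.
- by move=> mu_eq1; rewrite /z mu_eq1 subrr scale1r scale0r add0r.
move=> _; rewrite !kE !(pmulr_rgt0 _ a0) => vx0 vy0.
have := vL2 x y mu mu01; rewrite -/z.
(* Otherwise the right-hand side of the [L2] inequality is [-oo] while the left
   one is finite. *)
have zpos : 0 < k0 * u z.
  rewrite lt_def; have /andP[-> _] := v01 z; rewrite andbT.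
  apply/negP => /eqP z0; have := vL2 x y mu mu01.
  by rewrite -/z z0 (L2_pos vx0) (L2_pos vy0) /L2 eqxx -!EFinM -EFinD.
rewrite !L2_pos// -!EFinM -EFinD lee_fin !mulrN -opprD lerN2.
set wx := Num.sqrt (- ln (k0 * u x)).
set wy := Num.sqrt (- ln (k0 * u y)).
set wz := Num.sqrt (- ln (k0 * u z)) => wconv.
have vE w : 0 < k0 * u w ->
    k0 * u w = expR (- Num.sqrt (- ln (k0 * u w)) ^+ 2).
  by move=> w0; apply: expR_sqr_sqrt_ln; rewrite w0; have /andP[] := v01 w.
rewrite (vE x)// (vE y)// (vE z)//.
apply: le_trans (prof wx wy mu mu01) _.
apply: (admissible_le adm).
- by rewrite mulr_gt0 ?expR_gt0.
- by rewrite ler_pM2l// ler_expR lerN2 lerXn2r// nnegrE ?sqrtr_ge0//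
    (le_trans _ wconv) ?sqrtr_ge0.
- by rewrite -vE// -kE; have /andP[] := ku01 z.
Unshelve. all: by end_near. Qed.

Theorem lemma2p3 (R : realType) (N : nat) :
  (forall F : R -> \bar R, admissible F ->
     (exists2 t : R, 0 < t & F_concave F (gauss N t)) ->
     forall u : 'rV[R]_N -> R,
       bounded_fun u -> (forall x, 0 <= u x) ->
       F_concave L2 u -> F_concave F u) /\
  (forall t : R, 0 < t ->
     F_concave_class N L2 =
     \bigcap_(F in [set H : R -> \bar R |
                    admissible H /\ F_concave_class N H (gauss N t)])
       F_concave_class N F).
Proof.
split=> [F adm gaussF u _ _|t t0]; first exact: F_concave_of_L2_concave.
apply/seteqP; split => [u uL2 F [adm gaussF]|u uF].
  by apply: F_concave_of_L2_concave => //; exists t.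
apply: uF; split; [exact: admissible_L2 | exact: gauss_L2_concave].
Qed.
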